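(* The generating function $C(\lambda,\mu)=\sum_{m=1}^{\infty}\sum_{n=1}^{\infty}\frac{C_{mn}}{m!\,n!}\lambda^{n-1}\mu^{m-1}$ of the extended Bernoulli numbers is equal to $$C(\lambda,\mu)=\frac{e^{\mu}-1}{\lambda\mu}\cdot\left(\frac{\lambda+\mu}{e^{\lambda+\mu}-1}-\frac{\mu}{e^{\mu}-1}\right).$$
   Context: Bernoulli numbers: $\sum_{n\ge0}\frac{B_n}{n!}x^n=\frac{x}{e^x-1}$. The extended Bernoulli numbers $C_{mn}$ ($m,n\ge1$) are defined recursively by $C_{1n}=B_n$ and $$C_{m+1,n}=\frac{n}{n+1}C_{m,n+1}-\frac{1}{n+1}\sum_{k=1}^{n}\binom{n+1}{k}B_kC_{m,n-k+1}\qquad(m,n\ge1).$$ The identity is one of formal power series in $\lambda,\mu$. *)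

(* Defs.v *)
From HB Require Import structures.
From mathcomp Require Import all_boot all_algebra.
From mathcomp Require Import fraction boolp.

Set Implicit Arguments.
Unset Strict Implicit.
Unset Printing Implicit Defensive.

Import GRing.Theory.
Local Open Scope ring_scope.

(* Formal power series are wrapped in a record so that they do not inherit the
   pointwise ring structure that function types may carry. *)
Record fps (R : Type) := Fps { coefs :> nat -> R }.

Add Printing Constructor fps.

Notation "{ 'fps' R }" := (fps R) (format "{ 'fps'  R }") : type_scope.

HB.instance Definition _ (R : Type) := gen_eqMixin {fps R}.
HB.instance Definition _ (R : Type) := gen_choiceMixin {fps R}.

Lemma fpsP (R : Type) (f g : {fps R}) : (forall n, f n = g n) -> f = g.
Proof. by case: f g => [f] [g] /= fg; congr Fps; apply: funext. Qed.

Section FpsZmodule.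
Variable R : zmodType.
Implicit Types f g h : {fps R}.

Definition fps_zero : {fps R} := Fps (fun=> 0).
Definition fps_opp f := Fps (fun n => - f n).
Definition fps_add f g := Fps (fun n => f n + g n).

Fact fps_addA : associative fps_add.
Proof. by move=> f g h; apply: fpsP => n /=; rewrite addrA. Qed.
Fact fps_addC : commutative fps_add.
Proof. by move=> f g; apply: fpsP => n /=; rewrite addrC. Qed.
Fact fps_add0 : left_id fps_zero fps_add.
Proof. by move=> f; apply: fpsP => n /=; rewrite add0r. Qed.
Fact fps_addN : left_inverse fps_zero fps_opp fps_add.
Proof. by move=> f; apply: fpsP => n /=; rewrite addNr. Qed.

HB.instance Definition _ :=
  GRing.isZmodule.Build {fps R} fps_addA fps_addC fps_add0 fps_addN.

Lemma coefs0 n : (0 : {fps R}) n = 0. Proof. by []. Qed.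
Lemma coefsN f n : (- f) n = - f n. Proof. by []. Qed.
Lemma coefsD f g n : (f + g) n = f n + g n. Proof. by []. Qed.
Lemma coefsB f g n : (f - g) n = f n - g n. Proof. by []. Qed.

End FpsZmodule.

Section FpsRing.
Variable R : comNzRingType.
Implicit Types f g h : {fps R}.

Definition fpsC (c : R) : {fps R} := Fps (fun n => if n == 0%N then c else 0).
Definition fpsX : {fps R} := Fps (fun n => (n == 1%N)%:R).
Definition fps_mul f g : {fps R} :=
  Fps (fun n => \sum_(i < n.+1) f i * g (n - i)%N).

Fact fps_mulC : commutative fps_mul.
Proof.
move=> f g; apply: fpsP => n /=; rewrite (reindex_inj rev_ord_inj) /=.
by apply: eq_bigr => j _; rewrite (sub_ordK j) mulrC.
Qed.

Fact fps_mulA : associative fps_mul.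
Proof.
have mulr f g n : (fps_mul f g) n = \sum_(i < n.+1) f (n - i)%N * g i.
  by rewrite fps_mulC; apply: eq_bigr => j _; rewrite mulrC.
move=> p q r; apply: fpsP => i; rewrite [RHS]mulr [LHS]/=.
pose coef3 j k := p j * (q (i - j - k)%N * r k).
transitivity (\sum_(j < i.+1) \sum_(k < i.+1 | (k <= i - j)%N) coef3 j k).
  apply: eq_bigr => /= j _; rewrite -[X in _ * X = _]/((fps_mul q r) _).
  rewrite mulr big_distrr /=.
  by rewrite (big_ord_narrow_leq (leq_subr _ _)).
rewrite (exchange_big_dep predT) //=; apply: eq_bigr => k _.
transitivity (\sum_(j < i.+1 | (j <= i - k)%N) coef3 j k).
  apply: eq_bigl => j; rewrite -ltnS -(ltnS j) -!subSn ?leq_ord //.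
  by rewrite -subn_gt0 -(subn_gt0 j) -!subnDA addnC.
rewrite (big_ord_narrow_leq (leq_subr _ _)) big_distrl /=.
by apply: eq_bigr => j _; rewrite /coef3 -!subnDA addnC mulrA.
Qed.

Fact fps_mul1 : left_id (fpsC 1) fps_mul.
Proof.
move=> f; apply: fpsP => n /=; rewrite big_ord_recl /= subn0 mul1r.
by rewrite big1 ?addr0 // => i _; rewrite mul0r.
Qed.

Fact fps_mulDl : left_distributive fps_mul +%R.
Proof.
move=> f g h; apply: fpsP => n; rewrite coefsD /= -big_split.
by apply: eq_bigr => i _; rewrite mulrDl.
Qed.

Fact fps1_neq0 : fpsC 1 != 0.
Proof.
by apply/eqP => /(congr1 (fun f : {fps R} => f 0%N)) /= /eqP; rewrite oner_eq0.
Qed.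

HB.instance Definition _ := GRing.Zmodule_isComNzRing.Build {fps R}
  fps_mulA fps_mulC fps_mul1 fps_mulDl fps1_neq0.

Lemma coefs1 n : (1 : {fps R}) n = (n == 0%N)%:R.
Proof. by case: n. Qed.

Lemma coefsM f g n :
  (f * g) n = \sum_(i < n.+1) f i * g (n - i)%N.
Proof. by []. Qed.

End FpsRing.

Arguments fpsX {R}.

Section FpsUnitRing.
Variable R : comUnitRingType.
Implicit Types f g h : {fps R}.

Definition fps_unit : {pred {fps R}} := fun f : {fps R} => f 0%N \is a GRing.unit.

Fixpoint fps_inv_seq f n : seq R :=
  if n is m.+1 then
    let s := fps_inv_seq f m in
    rcons s (- (f 0%N)^-1 * \sum_(i < m.+1) f i.+1 * s`_(m - i))
  else [:: (f 0%N)^-1].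

Definition fps_inv f : {fps R} :=
  if f \in fps_unit then Fps (fun n => (fps_inv_seq f n)`_n) else f.

Lemma size_fps_inv_seq f n : size (fps_inv_seq f n) = n.+1.
Proof. by elim: n => //= n IHn; rewrite size_rcons IHn. Qed.

Lemma nth_fps_inv_seq f n i :
  (i <= n)%N -> (fps_inv_seq f n)`_i = (fps_inv_seq f i)`_i.
Proof.
elim: n => [|n IHn]; first by rewrite leqn0 => /eqP->.
rewrite leq_eqVlt => /predU1P[-> //|lt_in].
by rewrite /= nth_rcons size_fps_inv_seq lt_in IHn.
Qed.

Fact fps_mulVf : {in fps_unit, left_inverse 1 fps_inv *%R}.
Proof.
move=> f Uf; rewrite mulrC /fps_inv Uf; apply: fpsP => -[|n].
  by rewrite coefsM big_ord1 /= divrr.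
rewrite coefsM big_ord_recl /= nth_rcons size_fps_inv_seq ltnn eqxx.
rewrite mulNr mulrN mulVKr // addrC; apply/eqP; rewrite subr_eq0; apply/eqP.
apply: eq_bigr => i _; rewrite /bump /= add1n subSS.
by rewrite [in RHS]nth_fps_inv_seq ?leq_subr.
Qed.

Fact fps_unitPl f g : g * f = 1 -> f \in fps_unit.
Proof.
move=> /(congr1 (fun h : {fps R} => h 0%N)); rewrite coefsM big_ord1 /= => gf1.
by apply/unitrPr; exists (g 0%N); rewrite mulrC.
Qed.

Fact fps_inv_out : {in [predC fps_unit], fps_inv =1 id}.
Proof. by move=> f; rewrite inE /= /fps_inv => /negPf->. Qed.

HB.instance Definition _ := GRing.ComNzRing_hasMulInverse.Build {fps R}
  fps_mulVf fps_unitPl fps_inv_out.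

End FpsUnitRing.

Section FpsIdomain.
Variable R : idomainType.

Fact fps_idomain : GRing.integral_domain_axiom {fps R}.
Proof.
have low (f : {fps R}) : f != 0 ->
    exists2 n, f n != 0 & forall i, (i < n)%N -> f i = 0.
  move=> nz_f; have exf : exists n, f n != 0.
    apply: contrapT => f0; case/eqP: nz_f; apply: fpsP => n.
    by apply: contrapT => /eqP fn; apply: f0; exists n.
  exists (ex_minn exf); case: ex_minnP => // m _ min i; apply: contraTeq.
  by rewrite -leqNgt; apply: min.
move=> f g; apply: contra_eqT; rewrite negb_or.
move=> /andP[/low[a fa mina] /low[b gb minb]].
apply/eqP => /(congr1 (fun h : {fps R} => h (a + b)%N)) /eqP.
have lt_a : (a < (a + b).+1)%N by rewrite ltnS leq_addr.
rewrite coefsM (bigD1 (Ordinal lt_a)) //= addKn big1 ?addr0.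
  by rewrite mulf_eq0 (negPf fa) (negPf gb).
move=> i; rewrite -val_eqE neq_ltn /= => /orP[/mina->|lt_ai].
  by rewrite mul0r.
by rewrite [g _]minb ?mulr0 // ltn_subLR ?ltn_add2r // -ltnS.
Qed.

HB.instance Definition _ :=
  GRing.ComUnitRing_isIntegral.Build {fps R} fps_idomain.

End FpsIdomain.

Definition fps_exp : {fps rat} := Fps (fun n => (n`!)%:R^-1).

Lemma bernoulli_ex :
  exists B : nat -> rat,
    tofrac (Fps (fun n => B n / (n`!)%:R)) = tofrac fpsX / tofrac (fps_exp - 1).
Proof.
pose h : {fps rat} := Fps (fun n => (n.+1`!)%:R^-1).
have Uh : h \is a GRing.unit by change (h 0%N \is a GRing.unit).
have fact_nz n : (n`!)%:R != 0 :> rat by rewrite Num.Theory.pnatr_eq0 -lt0n fact_gt0.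
have Eh : fps_exp - 1 = fpsX * h.
  apply: fpsP => -[|n]; rewrite coefsM coefsB coefs1.
    by rewrite big_ord1 /= mul0r fact0 invr1 subrr.
  rewrite big_ord_recl big_ord_recl /= !mul0r add0r mul1r subr0 subSS subn0.
  by rewrite big1 ?addr0 // => i _; rewrite mul0r.
have nzX : fpsX != 0 :> {fps rat}.
  by apply/eqP => /(congr1 (fun f : {fps rat} => f 1%N)) /= /eqP; rewrite oner_eq0.
have nzh : h != 0 by apply: contraTneq Uh => ->; rewrite unitr0.
exists (fun n => (h^-1) n * (n`!)%:R).
have -> : Fps (fun n => (h^-1) n * (n`!)%:R / (n`!)%:R) = h^-1.
  by apply: fpsP => n /=; rewrite mulfK.
rewrite Eh tofracM invfM mulVKf ?tofrac_eq0 //.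
by rewrite -[RHS]mul1r; apply: (canRL (mulfK _)); rewrite ?tofrac_eq0 // -tofracM mulVr ?tofrac1.
Qed.

Definition bernoulli : nat -> rat := sval (cid bernoulli_ex).

Lemma bernoulliP :
  tofrac (Fps (fun n => bernoulli n / (n`!)%:R)) =
  tofrac fpsX / tofrac (fps_exp - 1).
Proof. exact: (svalP (cid bernoulli_ex)). Qed.

(* C_{mn}; only the values with m, n >= 1 are meaningful. *)
Fixpoint ext_bernoulli (m n : nat) : rat :=
  match m with
  | 0 => 0
  | 1 => bernoulli n
  | m'.+1 => n%:R / n.+1%:R * ext_bernoulli m' n.+1
      - n.+1%:R^-1 * \sum_(1 <= k < n.+1)
          'C(n.+1, k)%:R * bernoulli k * ext_bernoulli m' (n - k + 1)%N
  end.

(* Q[[lambda, mu]] is encoded as Q[[mu]][[lambda]]: the coefficient of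
   lambda^i mu^j in f is f i j. *)
Definition lambda : {fps {fps rat}} := fpsX.
Definition mu : {fps {fps rat}} := fpsC fpsX.

(* The substitution g(f) = sum_k g_k f^k, for f without constant term: then f^k
   has no monomial of total degree < k, so that truncating the sum at k = i + j
   leaves the coefficient of lambda^i mu^j unchanged. *)
Definition fps_subst2 (g : {fps rat}) (f : {fps {fps rat}}) : {fps {fps rat}} :=
  Fps (fun i => Fps (fun j =>
    \sum_(k < (i + j).+1) g k * (f ^+ k) i j)).

Definition fps_exp2 (f : {fps {fps rat}}) : {fps {fps rat}} :=
  fps_subst2 fps_exp f.

Lemma fps_exp2_mu_neq1 : fps_exp2 mu - 1 != 0.
Proof.
apply/eqP => /(congr1 (fun f : {fps {fps rat}} => f 0%N 1%N)) /eqP.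
rewrite !coefsB /= !big_ord_recl big_ord0 /=.
by rewrite mulr0 add0r addr0 subr0 invr1 mul1r oner_eq0.
Qed.

Lemma fps_exp2_lambda_mu_neq1 : fps_exp2 (lambda + mu) - 1 != 0.
Proof.
apply/eqP => /(congr1 (fun f : {fps {fps rat}} => f 0%N 1%N)) /eqP.
rewrite !coefsB /= !big_ord_recl big_ord0 /=.
by rewrite mulr0 !add0r addr0 subr0 invr1 mul1r oner_eq0.
Qed.

Lemma lambda_mu_neq0 : lambda * mu != 0.
Proof.
rewrite mulf_neq0 //.
  apply/eqP => /(congr1 (fun f : {fps {fps rat}} => f 1%N 0%N)) /eqP.
  by rewrite oner_eq0.
apply/eqP => /(congr1 (fun f : {fps {fps rat}} => f 0%N 1%N)) /eqP.
by rewrite oner_eq0.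
Qed.

(* The exponents n - 1 of lambda and m - 1 of mu are i and j. *)
Definition ext_bernoulli_gf : {fps {fps rat}} :=
  Fps (fun i => Fps (fun j =>
    ext_bernoulli j.+1 i.+1 / ((j.+1)`! * (i.+1)`!)%:R)).

(* Main.v *)
(** Write [b(x) = x / (e^x - 1)] and [H = lambda * mu * C(lambda, mu)].  The
    recursion for [C_{mn}] says exactly that [F = H] solves
    [lambda * (d/dmu - d/dlambda) F + b(lambda) F = lambda * (b(lambda) - 1)],
    and this equation has a unique solution vanishing at [mu = 0].  The claimed
    closed form, [(e^mu - 1) b(lambda + mu) - mu], is also such a solution,
    because [d/dmu - d/dlambda] kills [b(lambda + mu)]. *)
Require Import Defs.
From mathcomp Require Import all_boot all_algebra.
From mathcomp Require Import fraction.
From mathcomp Require Import ring.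

Set Implicit Arguments.
Unset Strict Implicit.
Unset Printing Implicit Defensive.

Import GRing.Theory.
Local Open Scope ring_scope.

(** * Coefficients of sums and of simple products *)

Lemma coefs_sum (R : zmodType) (I : Type) (r : seq I) (P : pred I)
    (F : I -> {fps R}) (n : nat) :
  (\sum_(i <- r | P i) F i) n = \sum_(i <- r | P i) F i n.
Proof. by apply: (big_morph (fun f : {fps R} => f n)). Qed.

Lemma coefsCM (R : comNzRingType) (c : R) (f : {fps R}) (n : nat) :
  (fpsC c * f) n = c * f n.
Proof.
rewrite coefsM big_ord_recl /= subn0 big1 ?addr0 // => i _.
by rewrite mul0r.
Qed.

Lemma coefsXM0 (R : comNzRingType) (f : {fps R}) : (fpsX * f) 0%N = 0.
Proof. by rewrite coefsM big_ord1 /= mul0r. Qed.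

Lemma coefsXMS (R : comNzRingType) (f : {fps R}) (n : nat) :
  (fpsX * f) n.+1 = f n.
Proof.
rewrite coefsM !big_ord_recl /= mul0r add0r mul1r subSS subn0 big1 ?addr0 //.
by move=> i _; rewrite mul0r.
Qed.

(** * Formal derivatives and their Leibniz rules *)

Section Derivative.
Variable R : comNzRingType.
Implicit Types f g : {fps R}.

Definition fps_deriv f : {fps R} := Fps (fun n => f n.+1 *+ n.+1).

Lemma fps_derivD f g : fps_deriv (f + g) = fps_deriv f + fps_deriv g.
Proof. by apply: fpsP => n; rewrite coefsD /= mulrnDl. Qed.

(** The weight [n.+1] on [f i * g (n.+1 - i)] splits as [i + (n.+1 - i)]. Each half loses one end
    term, of weight 0, and is then one of the two products. *)
Lemma fps_derivM f g :
  fps_deriv (f * g) = fps_deriv f * g + f * fps_deriv g.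
Proof.
apply: fpsP => n; rewrite coefsD [LHS]/= -sumrMnl.
have -> : \sum_(i < n.+2) f i * g (n.+1 - i)%N *+ n.+1 =
    \sum_(i < n.+2) f i * g (n.+1 - i)%N *+ i +
    \sum_(i < n.+2) f i * g (n.+1 - i)%N *+ (n.+1 - i).
  rewrite -big_split; apply: eq_bigr => i _ /=.
  by rewrite -mulrnDr subnKC // -ltnS.
congr (_ + _).
  rewrite big_ord_recl /= mulr0n add0r; apply: eq_bigr => i _ /=.
  by rewrite /bump /= add1n subSS mulrnAl.
rewrite big_ord_recr /= subnn mulr0n addr0; apply: eq_bigr => i _ /=.
by rewrite subSn ?mulrnAr // -ltnS.
Qed.

End Derivative.

(* [d/dmu - d/dlambda] *)
Definition diag_deriv (f : {fps {fps rat}}) : {fps {fps rat}} :=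
  Fps (fun i => Fps (fun j => f i j.+1 *+ j.+1 - f i.+1 j *+ i.+1)).

Lemma coefs_mulrn (R : zmodType) (f : {fps R}) (k n : nat) :
  (f *+ k) n = f n *+ k.
Proof. by elim: k => [|k IHk] //; rewrite !mulrS coefsD IHk. Qed.

(** Reduces the operator to one-variable derivatives, coefficientwise for [mu] and outer for
    [lambda], so that its Leibniz rule follows from [fps_derivM]. *)
Lemma diag_derivE f :
  diag_deriv f = Fps (fun i => fps_deriv (f i)) - fps_deriv f.
Proof.
by apply: fpsP => i; apply: fpsP => j; rewrite !coefsB /= coefs_mulrn.
Qed.

Lemma coefs_diag_deriv f i j :
  diag_deriv f i j = f i j.+1 *+ j.+1 - f i.+1 j *+ i.+1.
Proof. by []. Qed.

Lemma diag_derivB f g : diag_deriv (f - g) = diag_deriv f - diag_deriv g.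
Proof.
apply: fpsP => i; apply: fpsP => j.
by rewrite !coefsB !coefs_diag_deriv !coefsB; ring.
Qed.

Lemma diag_derivM (f g : {fps {fps rat}}) :
  diag_deriv (f * g) = diag_deriv f * g + f * diag_deriv g.
Proof.
rewrite !diag_derivE fps_derivM.
suff -> : Fps (fun i => fps_deriv ((f * g) i)) =
    Fps (fun i => fps_deriv (f i)) * g + f * Fps (fun i => fps_deriv (g i)).
  by ring.
apply: fpsP => i; rewrite coefsD !coefsM [LHS]/=.
rewrite -big_split /= (big_morph _ (@fps_derivD _) (_ : fps_deriv 0 = 0)) //.
  by apply: eq_bigr => k _; rewrite fps_derivM.
by apply: fpsP => n /=; rewrite mul0rn.
Qed.

Lemma diag_deriv1 : diag_deriv 1 = 0.
Proof.
apply: fpsP => i; apply: fpsP => j; rewrite coefs_diag_deriv.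
by case: i => [|i]; rewrite !coefs1 /= ?coefs1 /= ?coefs0 !mul0rn subr0.
Qed.

(** * Powers, substitutions and exponentials in [lambda] and [mu] *)

Lemma coefs_lambdaM0 f j : (lambda * f) 0%N j = 0.
Proof. by rewrite coefsXM0. Qed.

Lemma coefs_lambdaMS f i j : (lambda * f) i.+1 j = f i j.
Proof. by rewrite coefsXMS. Qed.

Lemma coefs_muM0 f i : (mu * f) i 0%N = 0.
Proof. by rewrite coefsCM coefsXM0. Qed.

Lemma coefs_muMS f i j : (mu * f) i j.+1 = f i j.
Proof. by rewrite coefsCM coefsXMS. Qed.

Lemma coefs_mu i j : mu i j = ((i == 0%N) && (j == 1%N))%:R.
Proof. by case: i. Qed.

Lemma diag_deriv_mu : diag_deriv mu = 1.
Proof.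
apply: fpsP => i; apply: fpsP => j; rewrite coefs_diag_deriv !coefs_mu.
by case: i j => [|i] [|j]; rewrite /= ?mul0rn ?subr0.
Qed.

(** The binomial theorem, by induction on [k] with Pascal's rule. *)
Lemma coefs_exp_lambda_mu k i j :
  ((lambda + mu) ^+ k) i j = ((i + j == k)%N * 'C(k, i))%:R.
Proof.
elim: k i j => [|k IHk] i j.
  by case: i j => [|i] [|j]; rewrite expr0 coefs1.
rewrite exprS mulrDl !coefsD.
case: i j => [|i] [|j].
- by rewrite coefs_lambdaM0 coefs_muM0 addr0.
- by rewrite coefs_lambdaM0 coefs_muMS IHk add0r !bin0 !add0n eqSS.
- rewrite coefs_lambdaMS coefs_muM0 IHk addr0 !addn0 eqSS.
  by case: eqP => [<-|_]; rewrite ?mul0n // !binn.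
- rewrite coefs_lambdaMS coefs_muMS !IHk !addSn !addnS eqSS -natrD.
  by rewrite -mulnDr binS (addnC (binomial _ _)).
Qed.

Lemma coefs_subst_lambda_mu g i j :
  fps_subst2 g (lambda + mu) i j = g (i + j)%N * 'C(i + j, i)%:R.
Proof.
(* By homogeneity only the power [k = i + j] contributes, and the truncated sum still contains
   it. *)
rewrite /= (bigD1 (inord (i + j))) //= coefs_exp_lambda_mu inordK // eqxx mul1n.
rewrite big1 ?addr0 // => k; rewrite coefs_exp_lambda_mu -val_eqE /= inordK //.
by rewrite eq_sym => /negPf->; rewrite mul0n mulr0.
Qed.

Lemma coefs_exp_mu k i j :
  (mu ^+ k) i j = ((i == 0%N) && (j == k))%:R.
Proof.
elim: k i j => [|k IHk] i j.
  by case: i j => [|i] [|j]; rewrite expr0 coefs1.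
by rewrite exprS; case: j => [|j]; rewrite ?coefs_muM0 ?andbF // coefs_muMS IHk.
Qed.

Lemma coefs_exp2_mu i j :
  fps_exp2 mu i j = if i == 0%N then (j`!)%:R^-1 else 0.
Proof.
rewrite /fps_exp2 /= (bigD1 (inord j)) //= coefs_exp_mu.
rewrite inordK ?ltnS ?leq_addl // eqxx andbT big1 ?addr0.
  by case: eqP => _; rewrite ?mulr1 ?mulr0.
move=> k; rewrite coefs_exp_mu -val_eqE /= inordK ?ltnS ?leq_addl //.
by rewrite eq_sym => /negPf->; rewrite andbF mulr0.
Qed.

Lemma factr_neq0 n : (n`!)%:R != 0 :> rat.
Proof. by rewrite Num.Theory.pnatr_eq0 -lt0n fact_gt0. Qed.

Lemma diag_deriv_exp2_mu : diag_deriv (fps_exp2 mu) = fps_exp2 mu.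
Proof.
apply: fpsP => i; apply: fpsP => j; rewrite coefs_diag_deriv !coefs_exp2_mu.
rewrite /= mul0rn subr0; case: eqP => _; last by rewrite mul0rn.
rewrite -[LHS]mulr_natr factS natrM invfM mulrAC mulVf ?mul1r //.
by rewrite Num.Theory.pnatr_eq0.
Qed.

(** The series f(lambda), constant in [mu]. *)
Definition fps_embed (R : comNzRingType) (f : {fps R}) : {fps {fps R}} :=
  Fps (fun i => fpsC (f i)).

Lemma coefs_embedM (R : comNzRingType) (f : {fps R}) (g : {fps {fps R}})
    (i j : nat) :
  (fps_embed f * g) i j = \sum_(k < i.+1) f k * g (i - k)%N j.
Proof. by rewrite coefsM coefs_sum; apply: eq_bigr => k _; rewrite coefsCM. Qed.

Lemma fps_embedM (R : comNzRingType) (f g : {fps R}) :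
  fps_embed (f * g) = fps_embed f * fps_embed g.
Proof.
apply: fpsP => i; apply: fpsP => j; rewrite coefs_embedM.
by case: j => [|j] //=; rewrite big1 // => k _; rewrite mulr0.
Qed.

(** Coefficientwise this is C(i+j,i) / (i+j)! = 1 / (i! j!). *)
Lemma exp2_lambda_mu :
  fps_exp2 (lambda + mu) = fps_embed fps_exp * fps_exp2 mu.
Proof.
apply: fpsP => i; apply: fpsP => j.
rewrite coefs_subst_lambda_mu coefs_embedM.
under eq_bigr do rewrite coefs_exp2_mu.
rewrite big_ord_recr /= subnn big1 ?add0r => [|k _]; last first.
  by rewrite subn_eq0 leqNgt ltn_ord mulr0.
have /(congr1 (fun n => n%:R : rat)) := bin_fact (leq_addr j i).
rewrite addKn !natrM => <-; rewrite !invfM mulrC mulVKf //.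
by rewrite Num.Theory.pnatr_eq0 -lt0n bin_gt0 leq_addr.
Qed.

(** The series (e^x - 1) / x. Its constant term is 1, so it is invertible. *)
Definition fps_expm1_quot : {fps rat} := Fps (fun n => (n.+1`!)%:R^-1).

Lemma fps_exp_sub1 : fps_exp - 1 = fpsX * fps_expm1_quot.
Proof.
apply: fpsP => -[|n]; rewrite coefsB coefs1.
  by rewrite coefsXM0 /= invr1 subrr.
by rewrite coefsXMS subr0.
Qed.

(** Since a substituted series has coefficients g_{i+j} C(i+j,i), multiplying it by [lambda + mu]
    shifts g by Pascal's rule. *)
Lemma exp2_lambda_mu_sub1 :
  fps_exp2 (lambda + mu) - 1 =
  (lambda + mu) * fps_subst2 fps_expm1_quot (lambda + mu).
Proof.
apply: fpsP => i; apply: fpsP => j.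
rewrite mulrDl !coefsB !coefsD coefs_subst_lambda_mu coefs1.
case: i j => [|i] [|j].
- by rewrite coefs_lambdaM0 coefs_muM0 /= invr1 !mulr1 subrr addr0.
- rewrite coefs_lambdaM0 coefs_muMS coefs_subst_lambda_mu coefs1 subr0.
  by rewrite add0r !add0n !bin0.
- rewrite coefs_lambdaMS coefs_muM0 coefs_subst_lambda_mu coefs0 subr0.
  by rewrite addr0 !addn0 !binn.
- rewrite coefs_lambdaMS coefs_muMS !coefs_subst_lambda_mu coefs0 subr0.
  by rewrite !addSn !addnS -mulrDr -natrD binS (addnC (binomial _ _)).
Qed.

(** * The Bernoulli series and the differential equation encoding the recursion *)

Definition bernoulli_fps : {fps rat} := Fps (fun n => bernoulli n / (n`!)%:R).

Lemma bernoulli_fpsM_exp : bernoulli_fps * (fps_exp - 1) = fpsX.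
Proof.
have nz : tofrac (fps_exp - 1) != 0.
  rewrite tofrac_eq0; apply/eqP => /(congr1 (fun f : {fps rat} => f 1%N)) /eqP.
  by rewrite coefsB /= subr0 invr1 oner_eq0.
by apply/eqP; rewrite -tofrac_eq tofracM bernoulliP divfK.
Qed.

Lemma bernoulli0 : bernoulli 0 = 1.
Proof.
have /(congr1 (fun f : {fps rat} => f 1%N)) := bernoulli_fpsM_exp.
rewrite fps_exp_sub1 mulrCA coefsXMS coefsM big_ord1 /= !invr1.
by rewrite !mulr1.
Qed.

(* The test on [i] is needed: [ext_bernoulli j 0] is a junk value, nonzero for
   [j = 1]. *)
Definition shifted_bernoulli_gf : {fps {fps rat}} := Fps (fun i => Fps (fun j =>
  if i == 0%N then 0 else ext_bernoulli j i / (j`! * i`!)%:R)).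

Lemma lambda_muM_ext_bernoulli_gf :
  lambda * mu * ext_bernoulli_gf = shifted_bernoulli_gf.
Proof.
apply: fpsP => -[|i]; apply: fpsP => j; rewrite -mulrA.
  by rewrite coefs_lambdaM0.
rewrite coefs_lambdaMS; case: j => [|j]; first by rewrite coefs_muM0 /= mul0r.
by rewrite coefs_muMS.
Qed.

Lemma ext_bernoulliSS m n :
  ext_bernoulli m.+2 n = n%:R / n.+1%:R * ext_bernoulli m.+1 n.+1
      - n.+1%:R^-1 * \sum_(1 <= k < n.+1)
          'C(n.+1, k)%:R * bernoulli k * ext_bernoulli m.+1 (n - k + 1)%N.
Proof. by []. Qed.

Lemma coefs_shifted_bernoulli_gf n m :
  shifted_bernoulli_gf n m =
  if n == 0%N then 0 else ext_bernoulli m n / (m`! * n`!)%:R.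
Proof. by []. Qed.

(** This is the recursion divided by (m+1)! n!, the factorials absorbing the binomial coefficients.
    It also holds for [n = 0], where both sides vanish. *)
Lemma coefs_shifted_bernoulli_gfSS n m :
  shifted_bernoulli_gf n m.+2 *+ m.+2 =
  shifted_bernoulli_gf n.+1 m.+1 *+ n
  - \sum_(1 <= k < n.+1)
      bernoulli_fps k * shifted_bernoulli_gf (n.+1 - k)%N m.+1.
Proof.
have -> : shifted_bernoulli_gf n m.+2 *+ m.+2 =
    ext_bernoulli m.+2 n / (m.+1`! * n`!)%:R.
  rewrite coefs_shifted_bernoulli_gf; case: eqP => [->|_].
    by rewrite mul0rn ext_bernoulliSS big_geq // !(mulr0, mul0r).
  rewrite -[LHS]mulr_natr (factS m.+1) -mulnA (natrM _ m.+2) invfM.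
  rewrite mulrCA mulrC mulVKf //.
  by rewrite Num.Theory.pnatr_eq0.
rewrite ext_bernoulliSS mulrBl; congr (_ - _).
  rewrite coefs_shifted_bernoulli_gf eqn0Ngt /= -[RHS]mulr_natr factS.
  by rewrite !natrM !invfM; ring.
rewrite mulr_sumr mulr_suml; apply: eq_big_nat => k /andP[k_gt0 k_le].
rewrite coefs_shifted_bernoulli_gf subn_eq0 leqNgt k_le addn1 -subSn //.
move: (ext_bernoulli _ _) => e; rewrite [bernoulli_fps k]/= (natrM _ _ n`!).
have -> : 'C(n.+1, k)%:R = n.+1%:R * n`!%:R / (k`! * (n.+1 - k)`!)%:R :> rat.
  rewrite -natrM -factS -(bin_fact (ltnW k_le)) natrM mulfK //.
  by rewrite natrM mulf_neq0 ?factr_neq0.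
rewrite !natrM /=; field.
by rewrite !factr_neq0 !nat1r !Num.Theory.pnatr_eq0.
Qed.

Lemma shifted_bernoulli_gf_pde :
  lambda * diag_deriv shifted_bernoulli_gf
    + fps_embed bernoulli_fps * shifted_bernoulli_gf =
  lambda * (fps_embed bernoulli_fps - 1).
Proof.
apply: fpsP => -[|n]; apply: fpsP => j; rewrite coefsD coefs_embedM.
  by rewrite !coefs_lambdaM0 big_ord1 /= mulr0 add0r.
rewrite !coefs_lambdaMS coefs_diag_deriv !coefsB coefs1.
(* The [mu]-free coefficients express C_{1n} = B_n, with B_0 = 1 cancelling the constant on the
   right; the others express the recursion. *)
case: j => [|m].
  rewrite big1 => [|k _]; last by rewrite /= mul0r if_same mulr0.
  rewrite /= mul0r mul0rn subr0 addr0.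
  case: eqP => [->|_]; last by rewrite coefs0 subr0 mul1n.
  by rewrite bernoulli0 divr1 subrr.
(* The term [k = 0] turns the factor [n.+1] from the derivative into the [n] of the recursion; the
   term [k = n.+1] vanishes. *)
have -> : \sum_(k < n.+2)
      bernoulli_fps k * shifted_bernoulli_gf (n.+1 - k)%N m.+1 =
    shifted_bernoulli_gf n.+1 m.+1 + \sum_(1 <= k < n.+1)
      bernoulli_fps k * shifted_bernoulli_gf (n.+1 - k)%N m.+1.
  rewrite -(big_mkord xpredT
    (fun k => bernoulli_fps k * shifted_bernoulli_gf (n.+1 - k)%N m.+1)).
  rewrite (big_nat_recr n.+1) // big_ltn // subnn /=.
  by rewrite mulr0 addr0 bernoulli0 divr1 mul1r.
have -> : fps_embed bernoulli_fps n m.+1 - ((n == 0%N)%:R : {fps rat}) m.+1 = 0.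
  by case: n => [|n]; rewrite ?coefs1 ?coefs0 subr0.
by rewrite coefs_shifted_bernoulli_gfSS [_ *+ n.+1]mulrS; ring.
Qed.

(** * Uniqueness of the solution and the closed form *)

Lemma lambda_pde_unique (b : {fps rat}) (f g : {fps {fps rat}}) :
    lambda * diag_deriv f + fps_embed b * f =
    lambda * diag_deriv g + fps_embed b * g ->
    (forall i, f i 0%N = g i 0%N) ->
  f = g.
Proof.
move=> fg fg0; apply: fpsP => i; apply: fpsP => j; elim: j i => [|j IHj] i //.
(* At lambda^(i+1) mu^j the only coefficient with [mu]-exponent above [j] is [f i j.+1], multiplied
   by [j.+1], which is nonzero in characteristic 0. *)
have /(congr1 (fun f : {fps {fps rat}} => f i.+1 j)) := fg.
rewrite !(coefsD, coefs_embedM) !coefs_lambdaMS !coefs_diag_deriv IHj.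
under eq_bigr do rewrite IHj.
move=> /addIr /addIr /eqP; rewrite -subr_eq0 -mulrnBl Num.Theory.mulrn_eq0 /=.
by rewrite subr_eq0 => /eqP.
Qed.

Theorem proposition2p12 :
  tofrac ext_bernoulli_gf =
  tofrac (fps_exp2 mu - 1) / tofrac (lambda * mu)
  * (tofrac (lambda + mu) / tofrac (fps_exp2 (lambda + mu) - 1)
     - tofrac mu / tofrac (fps_exp2 mu - 1)).
Proof.
(* Here u = (e^(lambda+mu) - 1) / (lambda + mu), so [u^-1] is b(lambda + mu) as a genuine power
   series. *)
set u := fps_subst2 fps_expm1_quot (lambda + mu).
have Uu : u \is a GRing.unit.
  change (u 0%N 0%N \is a GRing.unit).
  by rewrite coefs_subst_lambda_mu /= invr1 mulr1 unitr1.
(* The coefficients cancel through (j+1) C(i+j+1,i) = (i+1) C(i+j+1,i+1). *)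
have Du : diag_deriv u = 0.
  apply: fpsP => i; apply: fpsP => j; rewrite coefs_diag_deriv.
  rewrite (coefs_subst_lambda_mu _ i j.+1) (coefs_subst_lambda_mu _ i.+1 j).
  rewrite addSn -addnS -!mulrnAr -!mulrnA.
  by rewrite [(_ * i.+1)%N]mulnC mul_bin_left addKn mulnC subrr.
(* Differentiate [u * u^-1 = 1] and cancel the unit [u]. *)
have DVu : diag_deriv u^-1 = 0.
  apply: (mulrI Uu); rewrite mulr0 -diag_deriv1 -[in RHS](divrr Uu).
  by rewrite diag_derivM Du mul0r add0r.
have es : u^-1 * (fps_exp2 (lambda + mu) - 1) = lambda + mu.
  by rewrite exp2_lambda_mu_sub1 -/u mulrC mulrK.
have el : fps_embed bernoulli_fps * (fps_embed fps_exp - 1) = lambda.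
  have -> : fps_embed fps_exp - 1 = fps_embed (fps_exp - 1).
    apply: fpsP => i; apply: fpsP => j.
    by case: i j => [|i] [|j] //; apply: subr0.
  rewrite -fps_embedM bernoulli_fpsM_exp.
  by apply: fpsP => -[|[|i]]; apply: fpsP => -[|j].
(* The claim with denominators cleared, inside the power series ring. *)
have eH : lambda * mu * ext_bernoulli_gf = (fps_exp2 mu - 1) * u^-1 - mu.
  rewrite lambda_muM_ext_bernoulli_gf.
  apply: (@lambda_pde_unique bernoulli_fps); last first.
    (* Both sides vanish at [mu = 0], the right one because e^mu - 1 and [mu] do. *)
    move=> i; rewrite coefsB coefsM coefs_sum big1 => [|k _].
      by rewrite coefs_mu andbF subr0 /=; case: eqP => // _; rewrite mul0r.
    rewrite coefsM big_ord1 coefsB coefs_exp2_mu coefs1.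
    by case: (k : nat) => [|k']; rewrite /= ?invr1 ?subrr ?subr0 mul0r.
  rewrite shifted_bernoulli_gf_pde diag_derivB diag_derivM diag_derivB DVu.
  rewrite diag_deriv1 diag_deriv_mu diag_deriv_exp2_mu.
  move: es el; rewrite exp2_lambda_mu.
  (* Eliminating [mu] by [es] and then [lambda] by [el] leaves a polynomial identity in [b], [e],
     [m], [v]. *)
  move: (fps_embed bernoulli_fps) (fps_embed fps_exp) (fps_exp2 mu) (u^-1).
  move=> b e m v es el.
  have -> : mu = v * (e * m - 1) - lambda by rewrite es; ring.
  by rewrite -el; ring.
have nz_lm : tofrac (lambda * mu) != 0 by rewrite tofrac_eq0 lambda_mu_neq0.
have nz_m : tofrac (fps_exp2 mu - 1) != 0.
  by rewrite tofrac_eq0 fps_exp2_mu_neq1.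
have nz_s : tofrac (fps_exp2 (lambda + mu) - 1) != 0.
  by rewrite tofrac_eq0 fps_exp2_lambda_mu_neq1.
have -> : tofrac (lambda + mu) / tofrac (fps_exp2 (lambda + mu) - 1) =
    tofrac u^-1.
  by apply: (canLR (mulfK nz_s)); rewrite -tofracM es.
(* In the fraction field, multiplying by [lambda * mu] reduces the claim to [eH]. *)
apply: (mulfI nz_lm); rewrite -{1}tofracM eH.
rewrite (tofracB (_ * _)) (tofracM (fps_exp2 mu - 1)).
move: (tofrac _) (tofrac (fps_exp2 mu - 1)) (tofrac u^-1) nz_lm nz_m.
move=> lm e v lm0 e0.
by rewrite mulrA (mulrC lm) divfK // mulrBr (mulrC e (_ / e)) divfK.
Qed.
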